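(* Let $G$ be a finite group acting linearly on a finite-dimensional complex vector space $V$, with $\sigma:V\to\mathbb{C}^n$ as below. Let $I\subseteq\mathbb{R}$ be an interval and $c:I\to V/\!\!/G=\sigma(V)\subseteq\mathbb{C}^n$ continuous. Then there exists a continuous $\bar c:I\to V$ with $\sigma\circ\bar c=c$.
   Context: $\sigma=(\sigma_1,\dots,\sigma_n)$ where $\sigma_1,\dots,\sigma_n$ are homogeneous generators of the algebra $\mathbb{C}[V]^G$ of $G$-invariant polynomials; the quotient $V/\!\!/G$ is identified with $\sigma(V)\subseteq\mathbb{C}^n$. (For finite $G$ all orbits are closed, so a lift of $c$ is just a curve $\bar c$ with $\sigma\circ\bar c=c$.) *)

(* Defs.v *)
From HB Require Import structures.
From mathcomp Require Import all_boot all_algebra all_fingroup.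
From mathcomp Require Import mxrepresentation.
From mathcomp Require Import complex.
From mathcomp Require mpoly.
From mathcomp Require Import all_classical all_reals all_analysis.
Export numFieldTopology.Exports numFieldNormedType.Exports.

Set Implicit Arguments.
Unset Strict Implicit.
Unset Printing Implicit Defensive.

Local Open Scope ring_scope.

(* The complex numbers C = R[i] over a real field R (realType = complete
   archimedean ordered field), with the topology induced by the modulus. *)
Definition CC (R : realType) : numClosedFieldType := R[i].

Definition mevalv (R : realType) (d : nat)
  (p : mpoly.mpoly d (CC R)) (v : 'rV[CC R]_d) : CC R :=
  mpoly.meval (fun i => v ord0 i) p.

Definition invariant_poly (R : realType) (gT : finGroupType) (G : {group gT})
  (d : nat) (rG : mx_representation (CC R) G d) (p : mpoly.mpoly d (CC R)) :=
  forall g, g \in G -> forall v : 'rV[CC R]_d, mevalv p (v *m rG g) = mevalv p v.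

Definition homogeneous_poly (R : realType) (d : nat) (p : mpoly.mpoly d (CC R)) :=
  p \is mpoly.ishomog (mpoly.mpoly_mdeg__canonical__mpoly_Measure d).

Definition invariant_generators (R : realType) (gT : finGroupType)
  (G : {group gT}) (d : nat) (rG : mx_representation (CC R) G d) (n : nat)
  (sigma : n.-tuple (mpoly.mpoly d (CC R))) :=
  (forall i : 'I_n, homogeneous_poly (tnth sigma i)) /\
  (forall i : 'I_n, invariant_poly rG (tnth sigma i)) /\
  (forall p, invariant_poly rG p ->
     exists q : mpoly.mpoly n (CC R), p = mpoly.comp_mpoly sigma q).

Definition orbit_map (R : realType) (d n : nat)
  (sigma : n.-tuple (mpoly.mpoly d (CC R))) (v : 'rV[CC R]_d) : 'rV[CC R]_n :=
  \row_(i < n) mevalv (tnth sigma i) v.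

(* Main.v *)
Require Import Defs.
From mathcomp Require Import all_boot all_order all_algebra all_fingroup.
From mathcomp Require Import mxrepresentation.
From mathcomp Require Import complex.
From mathcomp Require mpoly.
From mathcomp Require Import all_classical all_reals all_analysis.
From mathcomp Require Import lra.
Import (canonicals, coercions) mpoly.
Import numFieldTopology.Exports numFieldNormedType.Exports.
Set Implicit Arguments.
Unset Strict Implicit.
Unset Printing Implicit Defensive.
Import Order.TTheory GRing.Theory Num.Theory.
Local Open Scope ring_scope.
Local Open Scope classical_set_scope.

(** The orbits over [c] form a continuous family for the Hausdorff distance: if
    a polynomial [f] vanishes on the orbit of [v], then [f x] is a root of
    [\prod_h ('X - f (x h))], whose coefficients are invariant, hence
    polynomials in [sigma x], and tend to those of a power of ['X] when
    [sigma x] tends to [sigma v]; products of coordinate differences are such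
    [f], so [x] tends to the orbit of [v].

    Given finitely many parameters, go through them in increasing order and
    choose each time the point of the next orbit nearest to the previous one.
    If all orbits over [[s, t]] are within [e] of each other, the chosen points
    move by steps at most [e] and stay within [e] of the finite orbit at [s], so
    the total displacement is at most [3 #|G| e], however many steps there are.
    This bound does not depend on the finite set of parameters, so compactness
    gives a selection on the whole interval satisfying it, and the bound is
    continuity. *)

(** * Polynomial functions, and a bound on the roots of a monic polynomial *)

Lemma meval_continuous (K : numFieldType) (d : nat) (q : mpoly.mpoly d K) :
  continuous (fun v : 'rV[K]_d => mpoly.meval (fun i => v ord0 i) q).
Proof.
under eq_fun do rewrite mpoly.mevalE.
apply: continuous_big => [|m _]; first exact: add_continuous.
have prod_cont : continuous (fun v : 'rV[K]_d => \prod_i v ord0 i ^+ m i).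
  apply: continuous_big => [|i _]; first exact: mul_continuous.
  elim: (m i) => [|k IH]; first exact: cst_continuous.
  under eq_fun do rewrite exprS.
  by move=> v; apply: (continuousM _ (IH v)); exact: coord_continuous.
by move=> v; apply: (continuousM _ (prod_cont v)); exact: cst_continuous.
Qed.

Section PolynomialFunctions.
Context {R : realType} {d : nat}.
Implicit Types f : 'rV[CC R]_d -> CC R.

(** Stated for functions, polynomiality follows from closure properties, even for matrix products
    and for coefficients of a product. *)
Definition polyfun f := exists p, forall v, mevalv p v = f v.

Lemma polyfun_cst a : polyfun (fun=> a).
Proof. by exists (mpoly.mpolyC d a) => v; exact: mpoly.mevalC. Qed.

Lemma polyfun_coord i : polyfun (fun v => v ord0 i).
Proof.
exists (mpoly.mpolyX (CC R) (mpoly.mnm1 i)) => v; exact: mpoly.mevalXU.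
Qed.

Lemma polyfunD f g : polyfun f -> polyfun g -> polyfun (fun v => f v + g v).
Proof.
by move=> [p pf] [q qg]; exists (p + q) => v; rewrite -pf -qg; exact: mpoly.mevalD.
Qed.

Lemma polyfunM f g : polyfun f -> polyfun g -> polyfun (fun v => f v * g v).
Proof.
by move=> [p pf] [q qg]; exists (p * q) => v; rewrite -pf -qg; exact: mpoly.mevalM.
Qed.

Lemma eq_polyfun f g : f =1 g -> polyfun f -> polyfun g.
Proof. by move=> /funext ->. Qed.

Lemma polyfunB f g : polyfun f -> polyfun g -> polyfun (fun v => f v - g v).
Proof.
move=> pf pg; apply: (eq_polyfun (f := fun v => f v + (-1) * g v)).
  by move=> v; rewrite mulN1r.
by apply: polyfunD => //; apply: polyfunM => //; exact: polyfun_cst.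
Qed.

Lemma polyfun_sum (J : Type) (r : seq J) (P : pred J) (F : J -> 'rV[CC R]_d -> CC R) :
  (forall j, polyfun (F j)) -> polyfun (fun v => \sum_(j <- r | P j) F j v).
Proof.
move=> pF; elim: r => [|j r IH].
  by apply: eq_polyfun (polyfun_cst 0) => v; rewrite big_nil.
apply: (eq_polyfun (f := fun v => (if P j then F j v else 0) + \sum_(j <- r | P j) F j v)).
  by move=> v; rewrite big_cons; case: (P j); rewrite ?add0r.
by apply: polyfunD => //; case: (P j) => //; exact: polyfun_cst.
Qed.

Lemma polyfun_prod (J : Type) (r : seq J) (P : pred J) (F : J -> 'rV[CC R]_d -> CC R) :
  (forall j, polyfun (F j)) -> polyfun (fun v => \prod_(j <- r | P j) F j v).
Proof.
move=> pF; elim: r => [|j r IH].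
  by apply: eq_polyfun (polyfun_cst 1) => v; rewrite big_nil.
apply: (eq_polyfun (f := fun v => (if P j then F j v else 1) * \prod_(j <- r | P j) F j v)).
  by move=> v; rewrite big_cons; case: (P j); rewrite ?mul1r.
by apply: polyfunM => //; case: (P j) => //; exact: polyfun_cst.
Qed.

Lemma polyfun_mulmx m (A : 'M[CC R]_(d, m)) j : polyfun (fun v => (v *m A) ord0 j).
Proof.
apply: (eq_polyfun (f := fun v => \sum_k v ord0 k * A k j)).
  by move=> v; rewrite mxE.
apply: polyfun_sum => k; apply: polyfunM; first exact: polyfun_coord.
exact: polyfun_cst.
Qed.

Lemma polyfun_coef_prod_XsubC (J : Type) (r : seq J) (P : pred J)
    (F : J -> 'rV[CC R]_d -> CC R) k :
  (forall j, polyfun (F j)) ->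
  polyfun (fun v => (\prod_(j <- r | P j) ('X - (F j v)%:P))`_k).
Proof.
move=> pF; elim: r k => [|j r IH] k.
  by apply: (eq_polyfun _ (polyfun_cst (1 : {poly CC R})`_k)) => v; rewrite big_nil.
case: (boolP (P j)) => Pj; last first.
  by apply: eq_polyfun (IH k) => v; rewrite big_cons (negbTE Pj).
apply: (eq_polyfun (f := fun v =>
   (if k == 0 then 0 else (\prod_(j <- r | P j) ('X - (F j v)%:P))`_k.-1)
     - F j v * (\prod_(j <- r | P j) ('X - (F j v)%:P))`_k)).
  by move=> v; rewrite big_cons Pj mulrBl coefB coefXM coefCM.
apply: polyfunB; last exact: polyfunM.
by case: (k == 0); [exact: polyfun_cst | exact: IH].
Qed.

Lemma mevalv_continuous (q : mpoly.mpoly d (CC R)) : continuous (mevalv q).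
Proof. exact: meval_continuous. Qed.

End PolynomialFunctions.

(** If [e < |z|], each lower term has modulus at most [|z| ^+ N / N.+1], where [N] is the degree;
    these [N] terms are too small to cancel [z ^+ N]. *)
Lemma norm_root_le (K : numFieldType) (p : {poly K}) (z e : K) :
  p \is monic -> root p z -> 0 < e ->
  (forall k, (k < (size p).-1)%N ->
     `|p`_k| <= e ^+ ((size p).-1 - k) / (size p)%:R) ->
  `|z| <= e.
Proof.
move=> p_mon /rootP; rewrite horner_coef.
have := monic_neq0 p_mon; rewrite -size_poly_gt0.
have := monicP p_mon; rewrite lead_coefE; case: (size p) => //= N pN _.
rewrite big_ord_recr/= pN mul1r => /eqP; rewrite addrC addr_eq0 => /eqP zN e0 small.
rewrite real_leNgt ?realE ?normr_ge0 ?(ltW e0)//; apply/negP => ez.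
have z0 : 0 < `|z| by exact: lt_trans ez.
suff : `|z| ^+ N < `|z| ^+ N by rewrite ltxx.
rewrite -{1}normrX zN normrN.
apply: le_lt_trans (ler_norm_sum _ _ _) _.
apply: (@le_lt_trans _ _ (\sum_(k < N) `|z| ^+ N / N.+1%:R)).
  apply: ler_sum => k _; rewrite normrM normrX.
  apply: le_trans (ler_wpM2r (exprn_ge0 _ (normr_ge0 _)) (small k (ltn_ord k))) _.
  rewrite mulrAC ler_wpM2r ?invr_ge0 ?ler0n//.
  rewrite -[X in _ <= `|z| ^+ X](subnK (ltnW (ltn_ord k))) exprD.
  by rewrite ler_wpM2r ?exprn_ge0// lerXn2r ?nnegrE ?(ltW e0) ?(ltW ez) ?(ltW z0).
rewrite sumr_const card_ord -[_ *+ N]mulr_natr -mulrA gtr_pMr ?exprn_gt0//.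
by rewrite mulrC ltr_pdivrMr ?ltr0Sn// mul1r ltr_nat.
Qed.

(** * Convergence to an orbit, read off from the invariants *)

Section OrbitMap.
Context {R : realType} {gT : finGroupType} {G : {group gT}} {d : nat}.
Context {rG : mx_representation (CC R) G d} {n : nat}.
Context {sigma : n.-tuple (mpoly.mpoly d (CC R))}.
Hypothesis Hsigma : invariant_generators rG sigma.

Lemma orbit_map_invariant g v : g \in G ->
  orbit_map sigma (v *m rG g) = orbit_map sigma v.
Proof.
by move=> gG; apply/rowP => i; rewrite !mxE; case: Hsigma => _ [inv _]; exact: inv.
Qed.

Lemma invariant_polyfun_factor (u : 'rV[CC R]_d -> CC R) : polyfun u ->
  (forall g v, g \in G -> u (v *m rG g) = u v) ->
  exists q, forall v, u v = mevalv q (orbit_map sigma v).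
Proof.
move=> [p pu] u_inv.
have p_inv : invariant_poly rG p by move=> g gG v; rewrite !pu u_inv.
have [_ [_ /(_ p p_inv)[q pq]]] := Hsigma.
exists q => v; rewrite -pu pq /mevalv mpoly.comp_mpoly_meval.
by apply: mpoly.meval_eq => i; rewrite mxE.
Qed.

Definition orbit_charpoly (f : 'rV[CC R]_d -> CC R) v : {poly CC R} :=
  \prod_(h in G) ('X - (f (v *m rG h))%:P).

Lemma orbit_charpoly_invariant f g v : g \in G ->
  orbit_charpoly f (v *m rG g) = orbit_charpoly f v.
Proof.
move=> gG; rewrite /orbit_charpoly [RHS](reindex_inj (mulgI g)).
apply: eq_big => [h|h hG]; first by rewrite groupMl.
by rewrite repr_mxM// mulmxA.
Qed.

Lemma orbit_charpoly_monic f v : orbit_charpoly f v \is monic.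
Proof. exact: monic_prod_XsubC. Qed.

Lemma size_orbit_charpoly f v : size (orbit_charpoly f v) = #|G|.+1.
Proof.
by rewrite /orbit_charpoly -big_enum size_prod_XsubC -cardE.
Qed.

Lemma root_orbit_charpoly f v : root (orbit_charpoly f v) (f v).
Proof.
rewrite /orbit_charpoly (bigD1 1%g)//= repr_mx1 mulmx1.
by rewrite rootM root_XsubC eqxx.
Qed.

Context {T : Type} {F : set_system T} {FF : Filter F}.
Context {w : T -> 'rV[CC R]_d} {v : 'rV[CC R]_d}.
Hypothesis wv : orbit_map sigma (w t) @[t --> F] --> orbit_map sigma v.

(* [f (w t)] is a root of a monic polynomial whose coefficients are invariant
   in [w t], hence tend to those of ['X^#|G|]. *)
Lemma near_orbit_vanishing (f : 'rV[CC R]_d -> CC R) (e : CC R) :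
  (forall h, polyfun (fun x => f (x *m rG h))) ->
  (forall h, h \in G -> f (v *m rG h) = 0) -> 0 < e ->
  \forall t \near F, `|f (w t)| <= e.
Proof.
move=> pf fv e0.
have vE : orbit_charpoly f v = 'X^#|G|.
  rewrite /orbit_charpoly (eq_bigr (fun=> 'X)) ?prodr_const// => h hG.
  by rewrite fv// subr0.
have coefs : \forall t \near F, forall k : 'I_#|G|,
    `|(orbit_charpoly f (w t))`_k| <= e ^+ (#|G| - k) / #|G|.+1%:R.
  apply: filter_forall => k.
  have [q qP] := @invariant_polyfun_factor (fun x => (orbit_charpoly f x)`_k)
    (polyfun_coef_prod_XsubC _ _ _ pf)
    (fun g x gG => congr1 (fun p : {poly _} => p`_k) (orbit_charpoly_invariant f x gG)).
  have q0 : mevalv q (orbit_map sigma v) = 0.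
    by rewrite -qP vE coefXn ltn_eqF.
  have cvg_q : mevalv q (orbit_map sigma (w t)) @[t --> F] --> (0 : CC R).
    rewrite -q0; apply: cvg_comp wv _; exact: mevalv_continuous.
  have e'0 : 0 < e ^+ (#|G| - k) / #|G|.+1%:R by rewrite divr_gt0 ?exprn_gt0 ?ltr0Sn.
  under eq_near do rewrite qP.
  by apply: cvgr0_norm_le e'0.
apply: filterS coefs => t coefs.
apply: (norm_root_le (orbit_charpoly_monic f (w t)) (root_orbit_charpoly f (w t)) e0).
by rewrite size_orbit_charpoly => k /= kG; exact: coefs (Ordinal kG).
Qed.

(** Each [f i] multiplies, over [g], one coordinate of a translate of [x - v *m rG g], so it
    vanishes on the orbit of [v]. There are finitely many [i], so all [f i (w t)] are eventually
    small together. Were [w t] far from every orbit point, the [i] that picks a large coordinate for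
    each [g] would give [e ^+ #|G| <= |f i (w t)|], against a bound by half of that. *)
Lemma near_orbit (e : CC R) : 0 < e ->
  \forall t \near F, exists2 g, g \in G & forall h j, h \in G ->
    `|((w t - v *m rG g) *m rG h) ord0 j| < e.
Proof.
move=> e0.
pose lam x g (b : gT * 'I_d) := ((x - v *m rG g) *m rG b.1) ord0 b.2.
pose f (i : {ffun gT -> gT * 'I_d}) x := \prod_(g in G) lam x g (i g).
have e'0 : 0 < e ^+ #|G| / 2 by rewrite divr_gt0 ?exprn_gt0.
have small : \forall t \near F, forall i, `|f i (w t)| <= e ^+ #|G| / 2.
  apply: filter_forall => i; apply: near_orbit_vanishing => // [h|h hG].
    apply: polyfun_prod => g.
    apply: (eq_polyfun (f := fun x => (x *m (rG h *m rG (i g).1)) ord0 (i g).2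
        - (v *m rG g *m rG (i g).1) ord0 (i g).2)).
      by move=> x; rewrite /lam mulmxBl mulmxA !mxE.
    by apply: polyfunB; [exact: polyfun_mulmx | exact: polyfun_cst].
  by rewrite /f (bigD1 h)//= /lam subrr mul0mx mxE mul0r.
apply: filterS small => t small.
apply: contrapT => /forall2NP far.
have far' g : g \in G -> exists b, e <= `|lam (w t) g b|.
  move=> gG; have [//|] := far g; move=> /existsNP[h /existsNP[j /not_implyP[hG lamj]]].
  exists (h, j); rewrite real_leNgt ?realE ?normr_ge0 ?(ltW e0)//; exact/negP.
(* [gT * 'I_d] is empty when [d] is 0, so the default value is extracted from [far']. *)
have [b0 _] := far' 1%g (group1 G).
pose i := [ffun g => odflt b0 [pick b | e <= `|lam (w t) g b|]].
have : e ^+ #|G| <= `|f i (w t)|.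
  rewrite /f normr_prod -prodr_const; apply: ler_prod => g gG.
  rewrite (ltW e0) /i ffunE; case: pickP => //= nob.
  by have [b] := far' g gG; rewrite nob.
move=> /le_trans/(_ (small i)); rewrite ler_pdivlMr//.
by rewrite ger_pMr ?exprn_gt0// lern1.
Qed.

End OrbitMap.

(** * Compactness and greedy selection *)

(** Take an ultrafilter [U] on lists containing, for each [x], the set of lists through [x]. As [L]
    is finite, [U]-almost all lists give [x] the same label: this is [l x]. For a pair [x], [y],
    some list contains both and gives both these labels. *)
Lemma finite_label_compactness (T : eqType) (L : finType)
    (P : T -> T -> L -> L -> Prop) :
  (forall s : seq T, exists l : T -> L,
     forall x y, x \in s -> y \in s -> P x y (l x) (l y)) ->
  exists l : T -> L, forall x y, P x y (l x) (l y).
Proof.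
move=> /choice[lam lamP].
pose F := filter_from [set: seq T] (fun s => [set s' : seq T | {subset s <= s'}]).
have FF : ProperFilter F.
  apply: filter_from_proper; last by move=> s _; exists s => /=.
  apply: filter_from_filter; first by exists [::].
  move=> s1 s2 _ _; exists (s1 ++ s2) => // s' /= ss'.
  by split=> x xs; apply: ss'; rewrite mem_cat xs ?orbT.
have [U [UU FU]] := ultraFilterLemma FF.
have FUx x : U [set s : seq T | x \in s].
  by apply: FU; exists [:: x] => // s /= /(_ x); apply; rewrite inE eqxx.
have ex_l x : exists a, U [set s : seq T | lam s x = a].
  apply: contrapT => /forallNP noa.
  suff : U set0 by exact: filter_not_empty.
  have Ua a : U [set s : seq T | lam s x <> a].
    by have [/noa|] := in_ultra_setVsetC [set s : seq T | lam s x = a] UU.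
  have : \forall s \near U, forall a, lam s x <> a by exact: filter_forall.
  by apply: filterS => s /(_ (lam s x)).
have [l lP] := choice ex_l.
exists l => x y.
have UI : U (([set s : seq T | x \in s] `&` [set s : seq T | y \in s]) `&`
    ([set s : seq T | lam s x = l x] `&` [set s : seq T | lam s y = l y])).
  by apply: filterI; exact: filterI.
by have [s [[xs ys] [<- <-]]] := filter_ex UI; exact: lamP.
Qed.

Section Selection.
Context {R : realDomainType} {X : Type} {dist : X -> X -> R}.
Hypothesis dist_refl : forall x, dist x x = 0.
Hypothesis dist_sym : forall x y, dist x y = dist y x.
Hypothesis dist_tri : forall x y z, dist x z <= dist x y + dist y z.

Lemma dist_path_le (L : finType) (a : L -> X) (e : R) g p :
  path (fun g h => dist (a g) (a h) <= e) g p ->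
  dist (a g) (a (last g p)) <= e *+ size p.
Proof.
elim: p g => [|h p IH] g /=; first by rewrite dist_refl.
move=> /andP[gh /IH hp]; rewrite mulrS.
by apply: le_trans (dist_tri _ (a h) _) _; exact: lerD.
Qed.

(* Replacing each point by the nearest [a g] gives a walk with steps at most
   [3 e] on the finite label set; removing its loops bounds its length. *)
Lemma dist_chain_le (T : eqType) (L : finType) (w : T -> X) (a : L -> X)
    (e : R) x p :
  path (fun u v => dist (w u) (w v) <= e) x p ->
  (forall u, u \in x :: p -> exists g, dist (w u) (a g) <= e) ->
  dist (w x) (w (last x p)) <= e *+ (3 * #|L|).
Proof.
move=> xp near_a.
have [g0 g0P] := near_a x (mem_head _ _).
(* Going from [w x] to [a g0] and back shows [0 <= e + e]. *)
have e0 : 0 <= e.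
  have := dist_tri (w x) (a g0) (w x).
  by rewrite dist_refl [X in _ + X]dist_sym; lra.
pose lab u := [arg min_(g < g0) dist (w u) (a g)]%O.
have labP u : u \in x :: p -> dist (w u) (a (lab u)) <= e.
  move=> /near_a[g gP]; rewrite /lab; case: Order.TotalTheory.arg_minP => // i _ /(_ g isT) ig.
  exact: le_trans ig gP.
have labp : path (fun g h => dist (a g) (a h) <= e *+ 3) (lab x) (map lab p).
  elim: p x xp {near_a g0P} labP => [//|y p IH] x /= /andP[xy yp] labP.
  rewrite IH// ?andbT; last by move=> u uyp; apply: labP; rewrite inE uyp orbT.
  have := labP x (mem_head _ _); have := labP y; rewrite !inE eqxx orbT => /(_ isT).
  have := dist_tri (a (lab x)) (w x) (a (lab y)).
  have := dist_tri (w x) (w y) (a (lab y)).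
  rewrite [dist (a _) (w x)]dist_sym !mulrS mulr0n; lra.
have lastE : last (lab x) (map lab p) = lab (last x p) by rewrite last_map.
case/shortenP: labp lastE => p' /dist_path_le ale uniqp' _ lastE.
have szp' : (size p' < #|L|)%N.
  by have := card_uniqP uniqp'; rewrite /= => <-; exact: max_card.
have : dist (a (lab x)) (a (lab (last x p))) <= e *+ 3 *+ (#|L|.-1).
  rewrite -lastE; apply: le_trans ale _.
  by apply: ler_wpMn2l; rewrite ?mulrn_wge0//; case: #|L| szp'.
(* One of the [#|L|] portions [e *+ 3] pays for the moves between [w] and [a] at the two ends. *)
have -> : e *+ (3 * #|L|) = e *+ 3 + e *+ 3 *+ (#|L|.-1).
  by rewrite -mulrS prednK ?mulrnA//; case: #|L| szp'.
have := labP x (mem_head _ _); have := labP (last x p) (mem_last _ _).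
have := dist_tri (w x) (a (lab x)) (w (last x p)).
have := dist_tri (a (lab x)) (a (lab (last x p))) (w (last x p)).
rewrite [dist (a (lab (last x p))) _]dist_sym.
rewrite [e *+ 3](mulrSr e 2) [e *+ 2]mulr2n; lra.
Qed.

(** A new last parameter gets the label nearest to the point chosen just before; [uniq] ensures that
    earlier labels are unchanged. *)
Lemma greedy_selection (T : eqType) (L : finType) (g0 : L) (o : T -> L -> X) s :
  uniq s ->
  exists l : T -> L, sorted (fun x y => [forall h,
    dist (o x (l x)) (o y (l y)) <= dist (o x (l x)) (o y h)]) s.
Proof.
case: s => [|x p] ; first by exists (fun=> g0).
elim/last_ind: p => [|p y IH]; first by exists (fun=> g0).
rewrite -rcons_cons rcons_uniq => /andP[yxp /IH[l lP]].
pose b h := dist (o (last x p) (l (last x p))) (o y h).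
exists (fun z => if z == y then [arg min_(h < g0) b h]%O else l z) => /=.
have neq z : z \in x :: p -> (z == y) = false.
  by move=> zxp; apply: contraNF yxp => /eqP <-.
rewrite rcons_path; apply/andP; split.
  move: lP; rewrite /=; congr is_true; apply: (@eq_in_path _ (mem (x :: p))); last exact/allP.
  by move=> u v uxp vxp; rewrite !neq.
rewrite neq ?mem_last// eqxx; apply/forallP => h.
by case: Order.TotalTheory.arg_minP => // i _; apply.
Qed.

(** [P] quantifies over all [e], so that one [l] serves every precision. For finitely many
    parameters, greedy choice along the sorted list meets the hypotheses of [dist_chain_le], with
    the finite set [o s] as reference points. *)
Lemma equicontinuous_selection (L : finType) (g0 : L) (o : R -> L -> X) :
  exists l : R -> L, forall s t e, s <= t ->
    (forall u v, s <= u <= t -> s <= v <= t ->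
       forall g, exists h, dist (o u g) (o v h) <= e) ->
    dist (o s (l s)) (o t (l t)) <= e *+ (3 * #|L|).
Proof.
pose P s t a b := forall e, s <= t ->
    (forall u v, s <= u <= t -> s <= v <= t ->
       forall g, exists h, dist (o u g) (o v h) <= e) ->
    dist (o s a) (o t b) <= e *+ (3 * #|L|).
suff [l lP] : exists l : R -> L, forall x y, P x y (l x) (l y).
  by exists l => s t e; exact: lP.
apply: finite_label_compactness => F.
pose s := sort <=%R (undup F).
have us : uniq s by rewrite sort_uniq undup_uniq.
have ss : pairwise <%R s.
  by rewrite -sorted_pairwise; [rewrite lt_sorted_uniq_le us sort_le_sorted | exact: lt_trans].
have [l lP] := greedy_selection g0 o us.
exists l => x y; rewrite -!(mem_undup F) -!(mem_sort <=%R (undup F)) -/s.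
move=> xs ys e xy clo.
(* Cutting the sorted list at [x], then at [y], keeps the parameters between them. *)
case/splitPr: xs ss lP ys => p1 p2 ss lP ys.
have {}ys : y \in x :: p2.
  move: ys; rewrite mem_cat => /orP[yp1|//].
  move: ss; rewrite pairwise_cat => /and3P[/allrelP/(_ y x yp1 (mem_head _ _))].
  by rewrite ltNge xy.
have [_ /= xp2] := cat_sorted2 lP.
move: ss; rewrite pairwise_cat => /and3P[_ _ /=/andP[xlt ss]].
case/splitPl: ys xy clo xp2 xlt ss => p3 p4 <-.
rewrite cat_path all_cat pairwise_cat.
move=> xy clo /andP[xp3 _] /andP[/allP xlt _] /and3P[_ ss _].
have mid u : u \in x :: p3 -> x <= u <= last x p3.
  rewrite inE => /predU1P[->|up3]; first by rewrite lexx.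
  rewrite (ltW (xlt _ up3))/=.
  case/lastP: p3 up3 ss {xlt xy clo xp3} => [//|p3 z].
  rewrite last_rcons mem_rcons inE pairwise_rcons => /predU1P[->|up3]; first by rewrite lexx.
  by move=> /andP[/allP/(_ _ up3)/ltW].
apply: (dist_chain_le (w := fun u => o u (l u)) (a := o x)); last first.
  by move=> u up3; apply: clo; [exact: mid | apply: mid; exact: mem_head].
apply: (sub_in_path (P := mem (x :: p3))) xp3; last exact/allP.
move=> u v ux vx /= /forallP uv.
(* The nearest label does at least as well as the label [h] given by closeness. *)
by have [h uh] := clo _ _ (mid _ ux) (mid _ vx) (l u); exact: le_trans (uv h) uh.
Qed.

End Selection.

(** * A distance for which the group acts by isometries *)

Section ComplexModulus.
Context {R : realType}.
Implicit Type z : CC R.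

(** The modulus takes values in the partially ordered [CC R], while the selection needs distances in
    a [realDomainType]. *)
Definition cnorm (z : CC R) : R := complex.Re `|z|.

Lemma cnormE z : `|z| = (cnorm z)%:C%C.
Proof. by rewrite /cnorm normc_def. Qed.

Lemma cnorm0 : cnorm 0 = 0.
Proof. by rewrite /cnorm normr0. Qed.

Lemma cnorm_ge0 z : 0 <= cnorm z.
Proof. by rewrite -lecR -cnormE normr_ge0. Qed.

Lemma cnormD z1 z2 : cnorm (z1 + z2) <= cnorm z1 + cnorm z2.
Proof. by rewrite -lecR rmorphD/= -!cnormE ler_normD. Qed.

End ComplexModulus.

Section InvariantDistance.
Context {R : realType} {gT : finGroupType} {G : {group gT}} {d : nat}.
Context {rG : mx_representation (CC R) G d}.
Implicit Types x y z : 'rV[CC R]_d.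

(* Summing over the group makes the action isometric. *)
Definition orbit_dist x y : R :=
  \sum_(h in G) \sum_j cnorm (((x - y) *m rG h) ord0 j).

Lemma orbit_distxx x : orbit_dist x x = 0.
Proof.
by rewrite /orbit_dist big1// => h _; rewrite big1// => j _;
  rewrite subrr mul0mx mxE cnorm0.
Qed.

Lemma orbit_distC x y : orbit_dist x y = orbit_dist y x.
Proof.
apply: eq_bigr => h _; apply: eq_bigr => j _.
by rewrite -opprB mulNmx mxE /cnorm normrN.
Qed.

Lemma orbit_dist_triangle x y z :
  orbit_dist x z <= orbit_dist x y + orbit_dist y z.
Proof.
rewrite -big_split; apply: ler_sum => h _; rewrite -big_split; apply: ler_sum => j _.
have -> : x - z = (x - y) + (y - z) by rewrite addrA subrK.
by rewrite mulmxDl mxE cnormD.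
Qed.

Lemma orbit_dist_isometry g x y : g \in G ->
  orbit_dist (x *m rG g) (y *m rG g) = orbit_dist x y.
Proof.
move=> gG; rewrite /orbit_dist [RHS](reindex_inj (mulgI g)).
apply: eq_big => [h|h hG]; first by rewrite groupMl.
by rewrite repr_mxM// -mulmxBl mulmxA.
Qed.

Lemma cnorm_le_orbit_dist x y j : 
  cnorm (x ord0 j - y ord0 j) <= orbit_dist x y.
Proof.
have -> : x ord0 j - y ord0 j = (x - y) ord0 j by rewrite !mxE.
rewrite /orbit_dist (bigD1 1%g)//= repr_mx1 mulmx1 (bigD1 j)//= -addrA lerDl.
by rewrite addr_ge0// sumr_ge0// => *; rewrite ?sumr_ge0// => *; exact: cnorm_ge0.
Qed.

Lemma orbit_dist_le x y e : (forall h j, h \in G ->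
    `|((x - y) *m rG h) ord0 j| < e%:C%C) ->
  orbit_dist x y <= e *+ (#|G| * d).
Proof.
move=> small; rewrite mulnC mulrnA -sumr_const; apply: ler_sum => h hG.
rewrite -[X in _ *+ X](card_ord d) -sumr_const; apply: ler_sum => j _.
by rewrite -lecR -cnormE ltW// small.
Qed.

(** With [a = b * k], the isometry [k] carries [y] close to [z *m rG a], hence to [x]; then [g]
    preserves the distance. *)
Lemma orbit_dist_translates x y z e a b g :
  a \in G -> b \in G -> g \in G ->
  orbit_dist x (z *m rG a) <= e -> orbit_dist y (z *m rG b) <= e ->
  exists2 h, h \in G & orbit_dist (x *m rG g) (y *m rG h) <= e + e.
Proof.
move=> aG bG gG xa yb.
have [k kG aE] : exists2 k, k \in G & a = (b * k)%g.
  by exists (b^-1 * a)%g; rewrite ?mulKVg// groupM ?groupV.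
exists (k * g)%g; first exact: groupM.
have -> : y *m rG (k * g)%g = y *m rG k *m rG g by rewrite repr_mxM ?mulmxA.
rewrite (orbit_dist_isometry _ _ gG).
apply: le_trans (orbit_dist_triangle _ (z *m rG a) _) (lerD xa _).
have -> : z *m rG a = z *m rG b *m rG k by rewrite aE repr_mxM ?mulmxA.
by rewrite (orbit_dist_isometry _ _ kG) orbit_distC.
Qed.

End InvariantDistance.

(** * The continuous lift *)

Theorem theorem5p1 (R : realType) (gT : finGroupType) (G : {group gT})
  (d : nat) (rG : mx_representation (CC R) G d) (n : nat)
  (sigma : n.-tuple (mpoly.mpoly d (CC R)))
  (Hsigma : invariant_generators rG sigma)
  (I : set R) (HI : is_interval I) (c : R -> 'rV[CC R]_n)
  (Hc : {within I, continuous c})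
  (HcV : forall t, I t -> exists v : 'rV[CC R]_d, orbit_map sigma v = c t) :
  exists cbar : R -> 'rV[CC R]_d,
    {within I, continuous cbar} /\
    (forall t, I t -> orbit_map sigma (cbar t) = c t).
Proof.
have /choice[w wP] : forall t, exists v, I t -> orbit_map sigma v = c t.
  move=> t; have [It|nIt] := pselect (I t); last by exists 0.
  by have [v vP] := HcV t It; exists v.
(* Labels in [subg_of G] form a finite type and keep every choice inside the orbit. *)
have [l lP] := equicontinuous_selection (@orbit_distxx _ _ _ _ rG) (@orbit_distC _ _ _ _ rG)
  (@orbit_dist_triangle _ _ _ _ rG) (1%g : subg_of G)
  (fun t g => w t *m rG (sgval g)).
exists (fun t => w t *m rG (sgval (l t))); split; last first.
  by move=> t It; rewrite (orbit_map_invariant Hsigma) ?wP ?subgP.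
apply/subspace_continuousP => t0 It0.
(* [w] may be discontinuous, but its image under [orbit_map sigma] agrees with [c] on [I]. *)
have wt0 : orbit_map sigma (w t) @[t --> within I (nbhs t0)] --> orbit_map sigma (w t0).
  rewrite wP//; move/subspace_continuousP : Hc => /(_ _ It0).
  apply: cvg_trans; apply: near_eq_cvg; rewrite near_withinE.
  by near=> t => It; rewrite wP.
have hausdorff (e : R) : 0 < e -> \forall t \near within I (nbhs t0),
    exists2 g, g \in G & @orbit_dist _ _ G _ rG (w t) (w t0 *m rG g) <= e.
  (* The successor keeps [M] nonzero when [d] is 0. *)
  move=> e0; pose M := (#|G| * d).+1.
  have e'0 : 0 < (e / M%:R)%:C%C :> CC R by rewrite ltcR divr_gt0.
  apply: filterS (near_orbit Hsigma wt0 e'0) => t [g gG tg]; exists g => //.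
  apply: le_trans (orbit_dist_le tg) _.
  by rewrite -[X in X <= _]mulr_natr mulrAC ler_pdivrMr ?ltr0Sn// ler_pM2l// ler_nat.
apply/cvg_ballP => e e0.
have [e1 e1_gt0 eE] : exists2 e1 : R, 0 < e1 & e = e1%:C%C.
  have eR : (complex.Re e)%:C%C = e by rewrite RRe_real// gtr0_real.
  by exists (complex.Re e); rewrite // -ltcR eR.
set K := (3 * #|subg_of G|)%N.
(* The last halving offsets the [e + e] of [orbit_dist_translates]; dividing by [K.+1] brings the
   factor [K] of the selection down to at most [e1 / 2]. *)
have e2 : 0 < e1 / 2 / K.+1%:R / 2 by rewrite !divr_gt0.
have := hausdorff _ e2; rewrite near_withinE => /nbhs_ballP[r r0 rP].
rewrite near_withinE; apply/nbhs_ballP; exists r => //= t tr It.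
have ord_close s1 s2 : s1 <= s2 -> I s1 -> I s2 -> ball t0 r s1 -> ball t0 r s2 ->
    @orbit_dist _ _ G _ rG (w s1 *m rG (sgval (l s1))) (w s2 *m rG (sgval (l s2))) < e1.
  move=> s12 I1 I2 b1 b2.
  (* [lP] asks for closeness at all parameters in between; convexity of [I] and of the ball provides
     it. *)
  have inball u : s1 <= u <= s2 -> I u /\ ball t0 r u.
    move=> /andP[s1u us2]; split; first by apply: (HI s1 s2) => //; rewrite s1u.
    move: b1 b2; rewrite /ball/= !ltr_distlC => /andP[? ?] /andP[? ?].
    by apply/andP; split; lra.
  apply: (@le_lt_trans _ _ (e1 / 2 / K.+1%:R *+ K)).
    apply: lP => // u v /inball[Iu bu] /inball[Iv bv] g.
    have [a aG ua] := rP u bu Iu; have [b bG vb] := rP v bv Iv.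
    have [h hG gh] := orbit_dist_translates aG bG (subgP g) ua vb.
    by exists (subg G h); rewrite subgK// [leRHS]splitr.
  rewrite -[X in X < _]mulr_natr mulrAC ltr_pdivrMr ?ltr0Sn//.
  apply: (@le_lt_trans _ _ (e1 / 2 * K.+1%:R)).
    by rewrite ler_pM2l ?divr_gt0// ler_nat.
  by rewrite ltr_pM2r ?ltr0Sn//; lra.
split=> // i j; rewrite ord1 /ball /= eE.
have bt0 : ball t0 r t0 by exact: ballxx.
rewrite cnormE ltcR.
have [t0t|tt0] := leP t0 t.
  by apply: le_lt_trans (ord_close _ _ t0t It0 It bt0 tr); exact: cnorm_le_orbit_dist.
apply: le_lt_trans (ord_close _ _ (ltW tt0) It It0 tr bt0).
by rewrite orbit_distC; exact: cnorm_le_orbit_dist.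
Unshelve. all: by end_near. Qed.
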